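(* Let $K$ be a field of characteristic $0$, let $n\ge4$ be even, and let $x=\sum_{i=1}^{n-1}e_{i,i+1}$ and $y=e_{n-1,1}+e_{n,2}$ in $\mathfrak{gl}(n,K)$. Let $\mathfrak{g}$ denote the Lie algebra generated by $x,y$. Then $\mathfrak{g}=\mathfrak{sl}(n,K)$.
   Context: $e_{i,j}$ denotes the $n\times n$ matrix with a $1$ in position $(i,j)$ and zeros elsewhere; $\mathfrak{gl}(n,K)$ carries the commutator bracket. The Lie algebra generated by $x,y$ is the smallest Lie subalgebra (over $K$) of $\mathfrak{gl}(n,K)$ containing $x$ and $y$. *)

(* Defs.v *)
From mathcomp Require Import all_boot all_algebra.
From mathcomp Require Import classical_sets.

Set Implicit Arguments.
Unset Strict Implicit.
Unset Printing Implicit Defensive.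

Import GRing.Theory.
Local Open Scope classical_set_scope.
Local Open Scope ring_scope.

Section LieAlgebra.
Variables (K : fieldType) (n : nat).
Implicit Types (A B : 'M[K]_n) (L X : set 'M[K]_n).

Definition lie_bracket A B : 'M[K]_n := A *m B - B *m A.

Definition lie_subalgebra L : Prop :=
  [/\ L 0,
      forall A B, L A -> L B -> L (A + B),
      forall (a : K) A, L A -> L (a *: A)
    & forall A B, L A -> L B -> L (lie_bracket A B)].

Definition lie_generated X : set 'M[K]_n := smallest lie_subalgebra X.

Definition sl : set 'M[K]_n := [set A | \tr A = 0].

(* Row and column positions i, j are numbered from 1 to n, whereas the
   ordinals of 'I_n start at 0, hence the successors. *)
Definition emx (i j : nat) : 'M[K]_n :=
  \matrix_(r, c) ((r.+1 == i) && (c.+1 == j))%:R.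

Definition xmx : 'M[K]_n := \sum_(1 <= i < n) emx i i.+1.

Definition ymx : 'M[K]_n := emx n.-1 1 + emx n 2.

End LieAlgebra.

Arguments sl : clear implicits.
Arguments emx : clear implicits.
Arguments xmx : clear implicits.
Arguments ymx : clear implicits.

(* Main.v *)
Require Import Defs.
From mathcomp Require Import all_boot all_algebra.
From mathcomp Require Import zify ring.
From mathcomp Require Import classical_sets.

(* The subalgebra generated by [x] and [y] contains a multiple of
   [x^(n-2) = e_{1,n-1} + e_{2,n}], namely [(ad x)^(2n-4) y], whose coefficient
   is up to sign a Catalan number. As [y^2 = 0], the subalgebra is stable under
   [u |-> y u y = - [y, [y, u]] / 2]; taking [u = [x^(n-2), (ad x)^(n-3) y]]
   gives [-2 e_{n,1}]. This is where parity enters: for odd [n] the two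
   contributions to the coefficient cancel. Then [(ad x)^(2n-2) e_{n,1}] is a
   multiple of [e_{1,n}] by a central binomial coefficient, [[x, e_{n,1}]] and
   [y] separate [e_{n-1,1}] from [e_{n,2}], and brackets with [x] fill the first
   row and column, which generate [sl]. *)

Import GRing.Theory.
Local Open Scope classical_set_scope.
Local Open Scope ring_scope.

(** * Matrix units, and multiplication by [x] as an index shift *)

Section Shift.
Variables (K : fieldType) (n : nat).
Local Notation e := (emx K n).
Local Notation x := (xmx K n).

Lemma emx_row_out i j : ~~ (0 < i <= n)%N -> e i j = 0.
Proof.
move=> iP; apply/matrixP => r c; rewrite !mxE.
suff -> : (r.+1 == i) = false by [].
by apply/eqP => h; move: iP; rewrite -h ltn_ord.
Qed.

Lemma emx_col_out i j : ~~ (0 < j <= n)%N -> e i j = 0.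
Proof.
move=> jP; apply/matrixP => r c; rewrite !mxE.
suff -> : (c.+1 == j) = false by rewrite andbF.
by apply/eqP => h; move: jP; rewrite -h ltn_ord.
Qed.

Lemma mul_emx i j k l :
  (0 < j <= n)%N -> e i j *m e k l = (j == k)%:R *: e i l.
Proof.
case: j => // j /= jn; apply/matrixP => r c; rewrite !mxE.
rewrite (bigD1 (Ordinal jn)) //= !mxE /= eqxx andbT big1 ?addr0 => [|t tj].
  by case: (r.+1 == i); case: (j.+1 == k); case: (c.+1 == l);
    rewrite ?(mulr0, mul0r, mulr1).
rewrite !mxE eqSS; suff -> : (t == j :> nat) = false by rewrite andbF mul0r.
by apply: contraNF tj => /eqP h; apply/eqP/val_inj.
Qed.

Lemma xmxE (r c : 'I_n) : x r c = (c == r.+1 :> nat)%:R.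
Proof.
rewrite /xmx summxE; have [crS|crS] := eqVneq (c : nat) r.+1.
  rewrite (bigD1_seq r.+1) ?iota_uniq ?mem_index_iota //=; last first.
    by rewrite -crS ltn_ord.
  rewrite mxE crS !eqxx big1 ?addr0 // => i ir.
  by rewrite mxE eq_sym (negbTE ir).
rewrite big1 // => i _; rewrite mxE eqSS.
by case: eqVneq => // <-; rewrite (negbTE crS).
Qed.

(** Row 1 moves to the fictitious row 0, hence to zero. The bound excludes [i = n.+1], where the
    left side is zero but [e n j] need not be. *)
Lemma mul_xmx_emx i j : (i <= n)%N -> x *m e i j = e i.-1 j.
Proof.
move=> in_; apply/matrixP => r c; rewrite !mxE.
case: i in_ => [|i] ilt /=.
  by rewrite big1 // => t _; rewrite mxE mulr0.
rewrite (bigD1 (Ordinal ilt)) //= xmxE !mxE /= eqxx big1 ?addr0 => [|t ti].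
  by rewrite (eq_sym i) /=; case: (_ == i); rewrite ?mul1r ?mul0r.
rewrite !mxE eqSS; suff -> : (t == i :> nat) = false by rewrite mulr0.
by apply: contraNF ti => /eqP h; apply/eqP/val_inj.
Qed.

Lemma mul_emx_xmx i j : (0 < j)%N -> e i j *m x = e i j.+1.
Proof.
case: j => // j _; apply/matrixP => r c; rewrite !mxE.
have [jn|nj] := ltnP j n; last first.
  rewrite big1 => [|t _]; last first.
    by rewrite mxE eqSS (ltn_eqF (leq_trans (ltn_ord t) nj)) andbF mul0r.
  have /ltn_eqF -> : (c.+1 < j.+2)%N.
    by rewrite ltnS (leq_trans (ltn_ord c)) // leqW.
  by rewrite andbF.
rewrite (bigD1 (Ordinal jn)) //= xmxE !mxE /= eqxx big1 ?addr0 => [|t tj].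
  by rewrite andbT eqSS; case: (_ == i); rewrite ?mul1r ?mul0r.
rewrite !mxE eqSS; suff -> : (t == j :> nat) = false by rewrite andbF mul0r.
by apply: contraNF tj => /eqP h; apply/eqP/val_inj.
Qed.

(* In 1-based indexing [emx 0 _ = 0] and [emx _ j = 0] for [j > n], so
   truncated subtraction yields the correct value when an index leaves the
   matrix. *)
Lemma iter_ad_xmx_emx k i j : (i <= n)%N -> (0 < j)%N ->
  iter k (lie_bracket x) (e i j) =
  \sum_(t < k.+1) ((-1) ^+ t * 'C(k, t)%:R) *: e (i + t - k) (j + t).
Proof.
move=> le_in j_gt0; elim: k => [|k IHk].
  by rewrite big_ord_recl big_ord0 mulr1 scale1r subn0 !addn0 addr0.
rewrite iterS IHk /lie_bracket mulmx_sumr mulmx_suml.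
rewrite [RHS]big_ord_recl /=.
(* Pascal's rule splits the sum: the ['C(k, t.+1)] part is left multiplication by [x], the
   ['C(k, t)] part is right multiplication. *)
under [X in _ = _ + X]eq_bigr => t _.
  rewrite /bump /= add1n binS natrD mulrDr scalerDl.
  over.
rewrite big_split /= addrA; congr (_ + _).
  under eq_bigr => t _.
    rewrite -scalemxAr mul_xmx_emx; last by have := ltn_ord t; lia.
    rewrite (_ : (i + t - k).-1 = i + t - k.+1)%N; last lia.
    over.
  (* The range is extended by one term, which is zero because ['C(k, k.+1) = 0]. *)
  transitivity (\sum_(t < k.+2) ((-1) ^+ t * 'C(k, t)%:R)
      *: e (i + t - k.+1) (j + t)).
    by rewrite [RHS]big_ord_recr /= bin_small // mulr0 scale0r addr0.
  by rewrite big_ord_recl /= !bin0.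
rewrite -sumrN; apply: eq_bigr => t _.
rewrite -scalemxAl mul_emx_xmx ?addn_gt0 ?j_gt0 //.
rewrite exprS mulN1r mulNr scaleNr; congr (- (_ *: e _ _)); lia.
Qed.

Lemma sl_lie_subalgebra : lie_subalgebra (sl K n).
Proof.
split=> [|A B|a A|A B _ _]; rewrite /sl /=.
- exact: mxtrace0.
- by rewrite mxtraceD => -> ->; rewrite addr0.
- by rewrite mxtraceZ => ->; rewrite mulr0.
by rewrite /lie_bracket raddfB /= mxtrace_mulC subrr.
Qed.

Lemma mxtrace_emx i j : i != j -> \tr (e i j) = 0.
Proof.
move=> ij; rewrite /mxtrace big1 // => k _; rewrite mxE.
by case: eqVneq => // ->; rewrite (negbTE ij).
Qed.

Lemma emx_sum (A : 'M[K]_n) :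
  A = \sum_i \sum_j A i j *: e i.+1 j.+1.
Proof.
rewrite [LHS]matrix_sum_delta; apply: eq_bigr => i _; apply: eq_bigr => j _.
by congr (_ *: _); apply/matrixP => r c; rewrite !mxE.
Qed.

End Shift.

(** * Closure properties of a Lie subalgebra, and criteria for it to contain [sl] *)

Section Subalgebra.
Variables (K : fieldType) (n : nat) (L : set 'M[K]_n).
Hypothesis L_lie : lie_subalgebra L.
Local Notation e := (emx K n).
Local Notation x := (xmx K n).

Lemma lie0 : L 0. Proof. by case: L_lie. Qed.

Lemma lieD A B : L A -> L B -> L (A + B).
Proof. by case: L_lie => _ h _ _; apply: h. Qed.

Lemma lieZ a A : L A -> L (a *: A).
Proof. by case: L_lie => _ _ h _; apply: h. Qed.

Lemma lie_br A B : L A -> L B -> L (lie_bracket A B).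
Proof. by case: L_lie => _ _ _; apply. Qed.

Lemma lieN A : L A -> L (- A).
Proof. by rewrite -scaleN1r; apply: lieZ. Qed.

Lemma lieB A B : L A -> L B -> L (A - B).
Proof. by move=> LA LB; apply: lieD => //; apply: lieN. Qed.

Lemma lieZK a A : a != 0 -> L (a *: A) -> L A.
Proof. by move=> a0 /(lieZ a^-1); rewrite scalerA mulVf // scale1r. Qed.

Lemma lie_sum (I : Type) (s : seq I) (P : pred I) (F : I -> 'M[K]_n) :
  (forall i, P i -> L (F i)) -> L (\sum_(i <- s | P i) F i).
Proof. by move=> LF; apply: big_ind => //; [exact: lie0 | exact: lieD]. Qed.

Lemma lie_iter_ad k A B : L A -> L B -> L (iter k (lie_bracket A) B).
Proof. by move=> LA LB; elim: k => //= k IHk; apply: lie_br. Qed.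

(** In [[A, [A, B]] = AAB - 2 ABA + BAA] the outer terms vanish. *)
Lemma lie_sandwich A B : A *m A = 0 -> (2%:R : K) != 0 ->
  L A -> L B -> L (A *m B *m A).
Proof.
move=> AA two0 LA LB; apply: (lieZK (- 2%:R)); first by rewrite oppr_eq0.
have := lie_br _ _ LA (lie_br _ _ LA LB); rewrite /lie_bracket.
rewrite mulmxBr mulmxBl !mulmxA AA mul0mx sub0r -[B *m A *m A]mulmxA AA mulmx0.
by rewrite subr0 scaleNr scaler_nat mulr2n opprD.
Qed.

(* Off-diagonal units generate everything of trace 0, since
   [e_{ii} - e_{11} = [e_{i1}, e_{1i}]]. *)
Lemma sl_sub_of_first_row_col :
  (forall i, (1 < i <= n)%N -> L (e i 1) /\ L (e 1 i)) -> sl K n `<=` L.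
Proof.
move=> Le A trA.
have Loff i j : (0 < i <= n)%N -> (0 < j <= n)%N -> i != j -> L (e i j).
  move=> iP jP ij.
  have [i1|i1] := eqVneq i 1%N.
    by rewrite i1; apply: (Le j _).2; lia.
  have [j1|j1] := eqVneq j 1%N.
    by rewrite j1; apply: (Le i _).1; lia.
  have iP' : (1 < i <= n)%N by lia.
  have jP' : (1 < j <= n)%N by lia.
  have := lie_br _ _ (Le i iP').1 (Le j jP').2.
  rewrite /lie_bracket !mul_emx; [|lia..].
  by rewrite eqxx scale1r (eq_sym j) (negbTE ij) scale0r subr0.
have Ldiag i : (0 < i <= n)%N -> L (e i i - e 1 1).
  move=> iP; have [->|i1] := eqVneq i 1%N; first by rewrite subrr; exact: lie0.
  have iP' : (1 < i <= n)%N by lia.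
  have := lie_br _ _ (Le i iP').1 (Le i iP').2.
  rewrite /lie_bracket !mul_emx; [|lia..].
  by rewrite !eqxx !scale1r.
(* Subtracting [\tr A *: e 1 1], which is zero, turns the diagonal part into a combination of the
   [e i i - e 1 1]. *)
rewrite -[A]subr0 -(scale0r (e 1 1)) -trA /mxtrace scaler_suml.
rewrite {1}(emx_sum _ _ A) -sumrB; apply: lie_sum => i _.
rewrite (bigD1 i) //= addrAC -scalerBr; apply: lieD.
  by apply: lieZ; apply: Ldiag; rewrite ltn_ord.
apply: lie_sum => j ji; apply: lieZ; apply: Loff; rewrite ?ltn_ord //.
by rewrite eqSS; apply: contraNneq ji => h; apply/eqP/val_inj.
Qed.

Lemma sl_sub_of_corners : (2 < n)%N ->
  L x -> L (e 1 n) -> L (e n 2) -> L (e n.-1 1) -> L (e n 1) ->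
  sl K n `<=` L.
Proof.
move=> n_gt2 Lx L1n Ln2 Ln'1 Ln1; apply: sl_sub_of_first_row_col.
have Le12 : L (e 1 2).
  have := lie_br _ _ L1n Ln2; rewrite /lie_bracket !mul_emx; [|lia..].
  by rewrite eqxx scale1r (_ : (2 == 1)%N = false) // scale0r subr0.
have Lrow k : (k.+2 <= n)%N -> L (e 1 k.+2).
  elim: k => // k IHk kn.
  (* Since [x] kills [e 1 _] from the left, bracketing with [x] is a pure column shift along row
     1. *)
  have := lie_br _ _ (IHk (ltnW kn)) Lx.
  rewrite /lie_bracket mul_emx_xmx // mul_xmx_emx ?(ltnW (ltnW kn)) //; last lia.
  by rewrite (emx_row_out _ _ 0) ?subr0.
have Lcol d : (d < n.-2)%N -> L (e (n.-1 - d) 1).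
  elim: d => [|d IHd] dn; first by rewrite subn0.
  have Ld := IHd (ltnW dn).
  (* [[x, e i 1] = e i.-1 1 - e i 2], and the unwanted [e i 2] is [[e i 1, e 1 2]] for [i] other
     than 2. *)
  have := lie_br _ _ Ld Le12; rewrite {1}/lie_bracket !mul_emx; [|lia..].
  rewrite eqxx scale1r (_ : (2 == n.-1 - d)%N = false); last lia.
  rewrite scale0r subr0 => Ld2.
  have := lieD _ _ (lie_br _ _ Lx Ld) Ld2.
  rewrite {1}/lie_bracket mul_xmx_emx ?mul_emx_xmx //; last lia.
  by rewrite subrK subnS.
move=> i iP; split.
  have [->//|i_n] := eqVneq i n.
  by rewrite (_ : i = n.-1 - (n.-1 - i))%N; [apply: Lcol; lia | lia].
by case: i iP => [|[|i]] // iP; apply: Lrow; lia.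
Qed.

End Subalgebra.

(** * Iterated brackets with [x], and the corner units obtained from [x] and [y] *)

Section Generation.
Variables (K : fieldType) (n : nat).
Hypotheses (charK0 : [pchar K] =i pred0) (n_ge4 : (4 <= n)%N).
Local Notation e := (emx K n).
Local Notation x := (xmx K n).
Local Notation y := (ymx K n).

(** A nonzero row requires [t >= n.-1] and a nonzero column [t <= n.-1], so a single term
    survives. *)
Lemma iter_ad_xmx_corner :
  iter (2 * n - 2) (lie_bracket x) (e n 1) =
  ((-1) ^+ n.-1 * 'C(2 * n - 2, n.-1)%:R) *: e 1 n.
Proof.
rewrite iter_ad_xmx_emx //.
have lt_n' : (n.-1 < (2 * n - 2).+1)%N by lia.
rewrite (bigD1 (Ordinal lt_n')) //= big1 ?addr0 => [|t tn].
  by congr (_ *: e _ _); lia.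
have {}tn : (t != n.-1 :> nat) by apply: contraNneq tn => h; apply/eqP/val_inj.
have [tlt|tge] := ltnP t n.-1.
  by rewrite emx_row_out ?scaler0 //; lia.
by rewrite emx_col_out ?scaler0 //; lia.
Qed.

Lemma iter_lie_bracketD k (A B C : 'M[K]_n) :
  iter k (lie_bracket A) (B + C) =
  iter k (lie_bracket A) B + iter k (lie_bracket A) C.
Proof.
elim: k => //= k ->; rewrite /lie_bracket mulmxDr mulmxDl opprD.
by rewrite addrACA.
Qed.

(** By the same range count, [e n.-1 1] contributes at [t = n - 2, n.-1] and [e n 2] at
    [t = n - 3, n - 2]. *)
Lemma iter_ad_xmx_ymx :
  iter (2 * n - 4) (lie_bracket x) y =
  ((-1) ^+ n * ('C(2 * n - 4, n - 2)%:R - 'C(2 * n - 4, n - 3)%:R)) *: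
    (e 1 n.-1 + e 2 n).
Proof.
have signn : (-1) ^+ (n - 2) = (-1) ^+ n :> K.
  by rewrite -signr_odd oddB ?addbF ?signr_odd //; lia.
have signn1 : (-1) ^+ n.-1 = - (-1) ^+ n :> K.
  by rewrite -{2}(prednK (_ : 0 < n)%N) ?exprS ?mulN1r ?opprK //; lia.
have signn3 : (-1) ^+ (n - 3) = - (-1) ^+ n :> K.
  by rewrite -signn1 -signr_odd -[RHS]signr_odd; congr (_ ^+ nat_of_bool _); lia.
have lt1 : (n.-1 < (2 * n - 4).+1)%N by lia.
have lt2 : (n - 2 < (2 * n - 4).+1)%N by lia.
have lt3 : (n - 3 < (2 * n - 4).+1)%N by lia.
have ord_neq k (t u : 'I_k) : t != u -> t != u :> nat by [].
rewrite /ymx iter_lie_bracketD !iter_ad_xmx_emx; [|lia..].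
rewrite (bigD1 (Ordinal lt2)) //= (bigD1 (Ordinal lt1)) /=; last first.
  by apply/eqP => -[]; lia.
rewrite big1 => [|t /andP[/ord_neq /= t2 /ord_neq /= t1]]; last first.
  have [tlt|tge] := ltnP t (n - 2).
    by rewrite emx_row_out ?scaler0 //; lia.
  by rewrite emx_col_out ?scaler0 //; lia.
rewrite (bigD1 (Ordinal lt3)) //= (bigD1 (Ordinal lt2)) /=; last first.
  by apply/eqP => -[]; lia.
rewrite big1 => [|t /andP[/ord_neq /= t3 /ord_neq /= t2]]; last first.
  have [tlt|tge] := ltnP t (n - 3).
    by rewrite emx_row_out ?scaler0 //; lia.
  by rewrite emx_col_out ?scaler0 //; lia.
rewrite !addr0 signn signn1 signn3.
rewrite (_ : n.-1 + (n - 2) - (2 * n - 4) = 1)%N; last lia.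
rewrite (_ : 1 + (n - 2) = n.-1)%N; last lia.
rewrite (_ : n.-1 + n.-1 - (2 * n - 4) = 2)%N; last lia.
rewrite (_ : 1 + n.-1 = n)%N; last lia.
rewrite (_ : n + (n - 3) - (2 * n - 4) = 1)%N; last lia.
rewrite (_ : 2 + (n - 3) = n.-1)%N; last lia.
rewrite (_ : n + (n - 2) - (2 * n - 4) = 2)%N; last lia.
rewrite (_ : 2 + (n - 2) = n)%N; last lia.
(* Binomial symmetry makes the coefficients of [e 1 n.-1] and [e 2 n] agree. *)
have: 'C(2 * n - 4, n.-1) = 'C(2 * n - 4, n - 3).
  have le_n' : (n.-1 <= 2 * n - 4)%N by lia.
  by rewrite -(bin_sub le_n'); congr 'C(_, _); lia.
move: ('C(2 * n - 4, n.-1)) ('C(2 * n - 4, n - 2)) ('C(2 * n - 4, n - 3)).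
move=> a b c ->.
rewrite addrACA -!scalerDl scalerDr; congr (_ *: _ + _ *: _); ring.
Qed.

(** For [n >= 4] the columns 1, 2 of [y] are disjoint from its rows [n.-1], [n]. *)
Lemma mul_ymx_ymx : y *m y = 0.
Proof.
rewrite /ymx mulmxDl !mulmxDr !mul_emx; [|lia..].
rewrite (_ : (1 == n.-1)%N = false); last lia.
rewrite (_ : (1 == n)%N = false); last lia.
rewrite (_ : (2 == n.-1)%N = false); last lia.
rewrite (_ : (2 == n)%N = false); last lia.
by rewrite !scale0r !addr0.
Qed.

Local Notation v := (e 1 n.-1 + e 2 n).

(** [y *m v] and [v *m y] project onto the last two and the first two coordinates, so only the two
    ends of the subdiagonal survive, with opposite signs. *)
Lemma ymx_ad_ymx t : (t.+2 <= n)%N ->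
  y *m lie_bracket v (e t.+2 t.+1) *m y =
  ((t.+2 == n)%:R - (t == 0)%:R) *: e n 1.
Proof.
move=> tn; rewrite /lie_bracket mulmxBr mulmxBl !mulmxA.
rewrite -[_ *m _ *m v *m y]mulmxA.
have -> : y *m v = e n.-1 n.-1 + e n n.
  rewrite /ymx mulmxDl !mulmxDr !mul_emx; [|lia..].
  by rewrite !scale0r !scale1r addr0 add0r.
have -> : v *m y = e 1 1 + e 2 2.
  rewrite /ymx mulmxDl !mulmxDr !mul_emx; [|lia..].
  rewrite !eqxx (_ : (n == n.-1)%N = false); last lia.
  rewrite (_ : (n.-1 == n)%N = false); last lia.
  by rewrite !scale0r !scale1r addr0 add0r.
rewrite /ymx !(mulmxDl, mulmxDr) !mul_emx; [|lia..].
rewrite -!scalemxAl !mul_emx; [|lia..].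
rewrite !scalerA -!natrM !mulnb.
rewrite (_ : (n == t.+2) && (t.+1 == n.-1) = (t.+2 == n)); last lia.
rewrite (_ : (2 == t.+2)%N && (t.+1 == 1)%N = (t == 0)%N); last lia.
rewrite (_ : (n.-1 == t.+2) && (t.+1 == n.-1) = false); last lia.
rewrite (_ : (n.-1 == t.+2) && (t.+1 == n) = false); last lia.
rewrite (_ : (n == t.+2) && (t.+1 == n) = false); last lia.
rewrite (_ : (1 == t.+2)%N && (t.+1 == 1)%N = false); last lia.
rewrite (_ : (1 == t.+2)%N && (t.+1 == 2)%N = false); last lia.
rewrite (_ : (2 == t.+2)%N && (t.+1 == 2)%N = false); last lia.
by rewrite !scale0r !addr0 !add0r scalerBl.
Qed.

(** The iterated bracket lies on the subdiagonal with alternating binomial weights; its two ends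
    leave [(-1) ^+ (n - 3) - 1]. *)
Lemma ymx_ad_ad_ymx : ~~ odd n ->
  y *m lie_bracket v (iter (n - 3) (lie_bracket x) y) *m y = - 2%:R *: e n 1.
Proof.
move=> n_even; rewrite iter_lie_bracketD !iter_ad_xmx_emx; [|lia..].
rewrite -big_split /=.
have lin A B a : y *m lie_bracket v (a *: A + B) *m y =
    a *: (y *m lie_bracket v A *m y) + y *m lie_bracket v B *m y.
  have -> : lie_bracket v (a *: A + B) = a *: lie_bracket v A + lie_bracket v B.
    rewrite /lie_bracket (mulmxDr v) (mulmxDl _ _ v) -scalemxAr -scalemxAl.
    by rewrite opprD addrACA -scalerBr.
  by rewrite (mulmxDr y) (mulmxDl _ _ y) -scalemxAr -scalemxAl.
transitivity (\sum_(t < (n - 3).+1) ((-1) ^+ t * 'C(n - 3, t)%:R *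
    ((t == n - 3 :> nat)%N%:R - (t == 0 :> nat)%N%:R)) *: e n 1).
  pose f A := y *m lie_bracket v A *m y.
  have f0 : f 0 = 0 by rewrite /f /lie_bracket !(mulmx0, mul0mx, subr0).
  have fD A B : f (A + B) = f A + f B by rewrite -{1}[A]scale1r /f lin scale1r.
  have fZ a A : f (a *: A) = a *: f A.
    by rewrite -[a *: A]addr0 /f lin -/(f 0) f0 addr0.
  rewrite -/(f _) (big_morph f fD f0); apply: eq_bigr => t _.
  have := ltn_ord t => tn.
  rewrite -scalerDr fZ fD -scalerA; congr (_ *: _).
  rewrite (_ : n.-1 + t - (n - 3) = t.+2)%N; last lia.
  rewrite (_ : n + t - (n - 3) = t.+3)%N; last lia.
  rewrite /f !ymx_ad_ymx; [|lia..].
  rewrite -scalerDl; congr (_ *: _).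
  rewrite (_ : (t.+2 == n) = false); last lia.
  rewrite (_ : (t.+3 == n) = (t == n - 3 :> nat)%N); last lia.
  by rewrite subr0 sub0r addrC.
rewrite -scaler_suml; congr (_ *: _).
have : odd (n - 3) by lia.
(* Being odd, [n - 3] is nonzero, so the first and last terms are distinct and can both be split
   off. *)
case: (n - 3)%N => // k k_odd; rewrite big_ord_recr big_ord_recl /=.
rewrite big1 => [|i _]; last first.
  by rewrite /bump /= add1n eqSS (ltn_eqF (ltn_ord i)) subrr mulr0.
rewrite -[(-1) ^+ k.+1]signr_odd k_odd !bin0 binn !eqxx /=; ring.
Qed.

(** An arbitrary [L] is taken because [lie_generated] is the intersection of all such
    subalgebras. *)
Lemma sl_sub_lie_xmx_ymx (L : set 'M[K]_n) : lie_subalgebra L -> ~~ odd n ->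
  L x -> L y -> sl K n `<=` L.
Proof.
move=> Llie n_even Lx Ly.
have natK0 m : (0 < m)%N -> (m%:R : K) != 0.
  by move=> m_gt0; rewrite ((pcharf0P K).1 charK0) -lt0n.
have two0 := natK0 2 isT.
have Lv : L v.
  have := lie_iter_ad _ _ _ Llie (2 * n - 4) _ _ Lx Ly.
  rewrite iter_ad_xmx_ymx; apply: (lieZK _ _ _ Llie).
  rewrite mulf_neq0 ?signr_eq0 //.
  (* Strictness comes from [(n - 2) * 'C(2 * n - 4, n - 2) = (n - 1) * 'C(2 * n - 4, n - 3)]. *)
  have lt_bin : ('C(2 * n - 4, n - 3) < 'C(2 * n - 4, n - 2))%N.
    have := mul_bin_left (2 * n - 4) (n - 3).
    have : (0 < 'C(2 * n - 4, n - 3))%N by rewrite bin_gt0; lia.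
    rewrite (_ : (n - 3).+1 = n - 2)%N; last lia.
    rewrite (_ : 2 * n - 4 - (n - 3) = (n - 2).+1)%N; last lia.
    move: ('C(2 * n - 4, n - 3)) ('C(2 * n - 4, n - 2)) => a b; nia.
  by rewrite -natrB ?natK0 ?subn_gt0 // ltnW.
have Ln1 : L (e n 1).
  apply: (lieZK _ _ _ Llie (- 2%:R)); first by rewrite oppr_eq0.
  rewrite -(ymx_ad_ad_ymx n_even).
  apply: (lie_sandwich _ _ _ Llie) => //; first exact: mul_ymx_ymx.
  by apply: (lie_br _ _ _ Llie) => //; exact: (lie_iter_ad _ _ _ Llie).
have L1n : L (e 1 n).
  have := lie_iter_ad _ _ _ Llie (2 * n - 2) _ _ Lx Ln1.
  rewrite iter_ad_xmx_corner; apply: (lieZK _ _ _ Llie).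
  by rewrite mulf_neq0 ?signr_eq0 // natK0 // bin_gt0; lia.
have Ldiff : L (e n.-1 1 - e n 2).
  have := lie_br _ _ _ Llie _ _ Lx Ln1.
  by rewrite /lie_bracket mul_xmx_emx // mul_emx_xmx.
have Ln'1 : L (e n.-1 1).
  apply: (lieZK _ _ _ Llie 2%:R) => //.
  (* Twice [e n.-1 1] is the sum of [e n.-1 1 - e n 2] and [y]. *)
  rewrite scaler_nat mulr2n -[X in X + _](subrK (e n 2)) -addrA.
  by rewrite [X in _ + X]addrC; exact: (lieD _ _ _ Llie).
apply: (sl_sub_of_corners _ _ _ Llie) => //; first lia.
rewrite -[e n 2](subKr (e n.-1 1)).
exact: (lieB _ _ _ Llie).
Qed.

End Generation.

Theorem proposition2p6 (K : fieldType) (n : nat)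
    (charK0 : [pchar K] =i pred0) (n_ge4 : (4 <= n)%N) (n_even : ~~ odd n) :
  lie_generated [set xmx K n; ymx K n] = sl K n.
Proof.
apply/seteqP; split=> [|A slA L [Llie LX]].
  apply: smallest_sub; first exact: sl_lie_subalgebra.
  move=> _ [] -> /=; rewrite /sl /=.
    rewrite /xmx raddf_sum big1 // => i _.
    by rewrite /= mxtrace_emx // neq_ltn ltnSn.
  by rewrite /ymx mxtraceD !mxtrace_emx ?addr0 //; lia.
by apply: (sl_sub_lie_xmx_ymx K n charK0 n_ge4 L Llie n_even) slA;
  apply: LX; [left | right].
Qed.
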